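(* Let $\mathcal{E}$ be a class of finite dimensional operator spaces and let $X$ be an operator space that has the $\mathcal{E}$-Gurariy property. If an operator space $Y$ satisfies $d_{cb}(Y,X)=1$, then $Y$ also has the $\mathcal{E}$-Gurariy property.
   Context: Operator spaces are (complete, complex) operator spaces; $\|\cdot\|_{cb}$ is the completely bounded norm. A cb-isomorphism between operator spaces is a linear bijection $\phi$ such that $\phi$ and $\phi^{-1}$ are completely bounded. For operator spaces $V,W$, the completely bounded Banach-Mazur distance is $d_{cb}(V,W)=\inf\{\|\phi\|_{cb}\|\phi^{-1}\|_{cb} : \phi:V\to W \text{ is a cb-isomorphism}\}$ (with $\inf\emptyset=\infty$). An operator space $X$ has the $\mathcal{E}$-Gurariy property if for any $\varepsilon>0$ and any pair of spaces $E\subseteq F$ with $F\in\mathcal{E}$ the following holds: for any injective linear map $u:E\to X$ there exists an injective linear extension $\widetilde{u}:F\to X$ of $u$ such that $\|\widetilde{u}\|_{cb}\|\widetilde{u}^{-1}\|_{cb}\le(1+\varepsilon)\|u\|_{cb}\|u^{-1}\|_{cb}$, where $u^{-1}:u(E)\to E$ and $\widetilde{u}^{-1}:\widetilde{u}(F)\to F$ are the inverses on the ranges. Convention: if the domain of $u$ is the zero space, the product $\|u\|_{cb}\|u^{-1}\|_{cb}$ is understood to be $1$. *)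

(* Defs.v *)
From HB Require Import structures.
From mathcomp Require Import all_boot all_order all_algebra.
From mathcomp Require Import complex.
From mathcomp Require Import all_classical all_reals all_analysis.

Set Implicit Arguments.
Unset Strict Implicit.
Unset Printing Implicit Defensive.

Import Order.TTheory GRing.Theory Num.Theory numFieldNormedType.Exports.
Local Open Scope classical_set_scope.
Local Open Scope ring_scope.
Local Open Scope complex_scope.

Section ScalarMatrices.
Context {R : realType}.

Definition l2norm m (v : 'cV[R[i]]_m) : R :=
  Num.sqrt (\sum_i ComplexField.Normc.normc (v i 0) ^+ 2).

(* The norm of [a] as an operator from Euclidean C^m to Euclidean C^n. The set
   is nonempty and bounded, so the real-valued [sup] is the true supremum. *)
Definition l2opnorm n m (a : 'M[R[i]]_(n, m)) : R :=
  sup [set l2norm (a *m v) | v in [set v : 'cV[R[i]]_m | l2norm v <= 1]].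

(* The product a x b of a vector-valued matrix [x] with scalar matrices. *)
Definition bimulmx (V : lmodType R[i]) n m (a : 'M[R[i]]_(n, m))
    (x : 'M[V]_m) (b : 'M[R[i]]_(m, n)) : 'M[V]_n :=
  \matrix_(i, j) \sum_k \sum_l (a i k * b l j) *: x k l.

End ScalarMatrices.

(* Operator spaces are presented abstractly, by Ruan's axioms: a complex Banach
   space V with a norm on each M_n(V), the norm on M_1(V) being that of V.
   The index n = 0 is allowed and harmless: M_0(V) = {0} has norm 0. *)
HB.mixin Record isOperatorSpace (R : realType) V
    of CompleteNormedModule R[i] V := {
  matnorm : forall n, 'M[V]_n -> R ;
  matnorm1 : forall x : V, (matnorm 1 (const_mx x))%:C = `|x| ;
  matnorm_triangle : forall n (x y : 'M[V]_n),
    matnorm n (x + y) <= matnorm n x + matnorm n y ;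
  matnormZ : forall n (c : R[i]) (x : 'M[V]_n),
    matnorm n (map_mx ( *:%R c) x) = ComplexField.Normc.normc c * matnorm n x ;
  matnorm0_eq0 : forall n (x : 'M[V]_n), matnorm n x = 0 -> x = 0 ;
  matnorm_dsum : forall m n (x : 'M[V]_m) (y : 'M[V]_n),
    matnorm (m + n)%N (block_mx x 0 0 y) =
      Num.max (matnorm m x) (matnorm n y) ;
  matnorm_bimul : forall m n (a : 'M[R[i]]_(n, m)) (x : 'M[V]_m)
      (b : 'M[R[i]]_(m, n)),
    matnorm n (bimulmx a x b) <= l2opnorm a * matnorm m x * l2opnorm b
}.

#[short(type="operatorSpaceType")]
HB.structure Definition OperatorSpace (R : realType) :=
  {V of isOperatorSpace R V & CompleteNormedModule R[i] V}.

Arguments matnorm {R V n} _ : rename.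

Section CompletelyBounded.
Context {R : realType}.
Implicit Types V W : operatorSpaceType R.

Definition finite_dimensional V : Prop :=
  exists (n : nat) (b : 'I_n -> V),
    forall x, exists c : 'I_n -> R[i], x = \sum_i c i *: b i.

(* A map on a subspace [A] of [V] is represented by a function on [V] whose
   values outside [A] are irrelevant. *)
Definition linear_on V W (A : set V) (u : V -> W) : Prop :=
  forall (c : R[i]) (x y : V), A x -> A y -> u (c *: x + y) = c *: u x + u y.

(* The cb-norm of the restriction of [u] to the subspace [A], where M_n(A)
   carries the norm induced by M_n(V). *)
Definition cbnorm V W (A : set V) (u : V -> W) : \bar R :=
  ereal_sup [set r | exists n (x : 'M[V]_n),
    [/\ forall i j, A (x i j), matnorm x <= 1
      & r = (matnorm (map_mx u x))%:E]].

(* The inverse u(A) -> A of the restriction of [u] to [A], when injective. *)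
Definition inv_on V W (A : set V) (u : V -> W) : W -> V :=
  'pinv_(fun=> 0) A u.

(* ||u||_cb ||u^-1||_cb for [u] on [A], taken to be 1 when A = {0}. *)
Definition cb_distortion V W (A : set V) (u : V -> W) : \bar R :=
  if `[< A = [set 0] >] then 1%E
  else (cbnorm A u * cbnorm (u @` A) (inv_on A u))%E.

Definition cb_isomorphism V W (phi : {linear V -> W}) : Prop :=
  [/\ bijective phi, (cbnorm setT phi < +oo)%E
    & (cbnorm setT (inv_on setT phi) < +oo)%E].

Definition d_cb V W : \bar R :=
  ereal_inf [set d | exists phi : {linear V -> W},
    cb_isomorphism phi /\ d = cb_distortion setT phi].

Definition Gurariy (EE : operatorSpaceType R -> Prop) (X : operatorSpaceType R)
    : Prop :=
  forall (eps : R), 0 < eps ->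
  forall F : operatorSpaceType R, EE F ->
  forall E : set F, submod_closed (mem E) ->
  forall u : F -> X, linear_on E u -> {in E &, injective u} ->
  exists ut : {linear F -> X},
    [/\ injective ut, {in E, ut =1 u}
      & (cb_distortion setT ut <= (1 + eps)%:E * cb_distortion E u)%E].

End CompletelyBounded.

(* Main.v *)
Require Import Defs.
From HB Require Import structures.
From mathcomp Require Import all_boot all_order all_algebra.
From mathcomp Require Import complex lra.
From mathcomp Require Import all_classical all_reals all_analysis.

(** Pick a cb-isomorphism [phi : Y -> X] of distortion at most [1 + d].  To
    extend [u : E -> Y], extend [phi \o u] into [X] and compose the extension
    with [phi^-1].  Distortion is submultiplicative, so the two compositions and
    the Gurariy extension cost a factor [1 + d] each, and
    [(1 + d) ^ 3 <= 1 + eps] for small [d]. *)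

Import Order.TTheory GRing.Theory Num.Theory numFieldNormedType.Exports.
Local Open Scope classical_set_scope.
Local Open Scope ring_scope.

Section Matnorm.
Context {R : realType}.
Implicit Types V : operatorSpaceType R.

Lemma matnorm0 V n : matnorm (0 : 'M[V]_n) = 0.
Proof.
have -> : (0 : 'M[V]_n) = map_mx ( *:%R (0 : R[i])) 0.
  by apply/matrixP => i j; rewrite !mxE scale0r.
by rewrite matnormZ ComplexField.Normc.normc0 mul0r.
Qed.

(** Positivity is not among the axioms. It comes from the triangle inequality and homogeneity: the
    zero matrix is [x + (-1) x], so its norm 0 is at most twice that of [x]. *)
Lemma matnorm_ge0 V n (x : 'M[V]_n) : 0 <= matnorm x.
Proof.
have := matnorm_triangle n x (map_mx ( *:%R (- 1 : R[i])) x).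
have -> : x + map_mx ( *:%R (- 1 : R[i])) x = 0.
  by apply/matrixP => i j; rewrite !mxE scaleN1r subrr.
rewrite matnorm0 matnormZ (@normcN R) ComplexField.Normc.normc1 mul1r.
by move: (matnorm x) => t; lra.
Qed.

End Matnorm.

Section LinearOn.
Context {R : realType}.
Implicit Types V W : operatorSpaceType R.

Lemma linear_onZ {V W} {A : set V} {f : V -> W} :
  submod_closed (mem A) -> linear_on A f ->
  forall (c : R[i]) x, A x -> f (c *: x) = c *: f x.
Proof.
move=> [A0 _] flin c x Ax; have {}A0 : A 0 by apply: set_mem.
have f0 : f 0 = 0.
  have := flin 1 0 0 A0 A0; rewrite !scale1r addr0 => /eqP.
  by rewrite -subr_eq0 opprD addNKr oppr_eq0 => /eqP.
by rewrite -[c *: x]addr0 flin// f0 addr0.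
Qed.

Lemma submod_image {V W} {A : set V} {f : V -> W} :
  submod_closed (mem A) -> linear_on A f -> submod_closed (mem (f @` A)).
Proof.
move=> Asub flin; have [A0 Alin] := Asub.
split=> [|c _ _ /set_mem[x Ax <-] /set_mem[y Ay <-]]; apply/mem_set.
- exists 0; first exact: set_mem.
  by rewrite -(scale0r 0) (linear_onZ Asub flin) ?scale0r//; exact: set_mem.
- exists (c *: x + y); last exact: flin.
  by apply/set_mem/Alin; exact: mem_set.
Qed.

Lemma inv_onK {V W} {A : set V} {f : V -> W} : {in A &, injective f} ->
  forall x, A x -> inv_on A f (f x) = x.
Proof. by move=> finj x Ax; apply: pinvKV => //; exact: mem_set. Qed.

Lemma linear_on_inv {V W} {A : set V} {f : V -> W} :
  submod_closed (mem A) -> linear_on A f -> {in A &, injective f} ->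
  linear_on (f @` A) (inv_on A f).
Proof.
move=> [_ Alin] flin finj c _ _ [x Ax <-] [y Ay <-].
rewrite -flin// !inv_onK//; apply/set_mem/Alin; exact: mem_set.
Qed.

End LinearOn.

Section CbNorm.
Context {R : realType}.
Implicit Types V W Z : operatorSpaceType R.

Lemma cbnorm_ge0 V W (A : set V) (f : V -> W) : (0 <= cbnorm A f)%E.
Proof.
(* The 0 x 0 matrix has no entries to constrain, so it shows that 0 is a member of the set even when
   [A] is empty. *)
apply: ereal_sup_ubound; exists 0%N, 0; split => [[]//||].
  by rewrite matnorm0 ler01.
by rewrite [map_mx _ _]flatmx0 matnorm0.
Qed.

Lemma cbnorm_subset V W (A B : set V) (f : V -> W) :
  A `<=` B -> (cbnorm A f <= cbnorm B f)%E.
Proof.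
move=> AB; apply: ereal_sup_le => _ [n [x [Ax x1 ->]]].
by exists n, x; split=> // i j; exact: AB.
Qed.

Lemma eq_cbnorm V W (A : set V) (f g : V -> W) :
  (forall x, A x -> f x = g x) -> cbnorm A f = cbnorm A g.
Proof.
move=> fg; congr ereal_sup; apply/seteqP.
by split=> _ [n [x [Ax x1 ->]]]; exists n, x; split=> //; congr (matnorm _)%:E;
  apply/matrixP => i j; rewrite !mxE fg.
Qed.

(** For [x] in the unit ball, [y = f(x)] has norm at most [cbnorm A f]. Dividing [y] by its norm
    stays inside the subspace [B] and gives a test matrix for [cbnorm B g]. *)
Lemma cbnorm_comp V W Z (A : set V) (B : set W) (f : V -> W) (g : W -> Z) :
  (forall x, A x -> B (f x)) -> submod_closed (mem B) -> linear_on B g ->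
  (cbnorm A (g \o f) <= cbnorm B g * cbnorm A f)%E.
Proof.
move=> AB Bsub glin; have gZ := linear_onZ Bsub glin.
have [B0 Blin] := Bsub.
have BZ (c : R[i]) y : B y -> B (c *: y).
  move=> By; rewrite -[_ *: _]addr0; apply/set_mem/Blin => //; exact: mem_set.
apply: ge_ereal_sup => _ [n [x [Ax x1 ->]]].
have fx : ((matnorm (map_mx f x))%:E <= cbnorm A f)%E.
  by apply: ereal_sup_ubound; exists n, x.
rewrite map_mx_comp; move: fx.
have : forall i j, B (map_mx f x i j) by move=> i j; rewrite mxE; exact: AB.
move: (map_mx f x) => {x Ax x1} y By yf.
(* A matrix of norm zero cannot be normalised, but it vanishes by definiteness, and so does its
   image under [g]. *)
have [y0|yn0] := eqVneq (matnorm y) 0.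
  have -> : map_mx g y = 0.
    rewrite (matnorm0_eq0 _ _ y0); apply/matrixP => i j; rewrite !mxE.
    by rewrite -(scale0r 0) gZ ?scale0r//; exact: set_mem.
  by rewrite matnorm0 mule_ge0// cbnorm_ge0.
pose t := matnorm y; have t_gt0 : 0 < t by rewrite lt_def yn0 matnorm_ge0.
pose c : R[i] := (t^-1)%:C%C.
have normc_c : ComplexField.Normc.normc c = t^-1.
  by rewrite /= expr0n addr0 sqrtr_sqr ger0_norm// invr_ge0 ltW.
have gc : ((t^-1 * matnorm (map_mx g y))%:E <= cbnorm B g)%E.
  apply: ereal_sup_ubound; exists n, (map_mx ( *:%R c) y); split.
  - by move=> i j; rewrite mxE; exact: BZ.
  - by rewrite matnormZ normc_c mulVf.
  - rewrite -normc_c -matnormZ; congr (matnorm _)%:E.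
    by apply/matrixP => i j; rewrite !mxE gZ.
(* The cb-norms may be infinite, so the two factors are compared one by one instead of dividing an
   inequality by [t]. *)
have -> : matnorm (map_mx g y) = (t^-1 * matnorm (map_mx g y)) * t.
  by rewrite mulrAC mulVf ?mul1r.
rewrite EFinM lee_pmul ?lee_fin ?(ltW t_gt0)//.
by rewrite mulr_ge0 ?matnorm_ge0// invr_ge0 ltW.
Qed.

Lemma cbnorm_set0 V W (f : V -> W) : f 0 = 0 -> cbnorm [set 0] f = 0%E.
Proof.
move=> f0; apply/eqP; rewrite eq_le cbnorm_ge0 andbT.
apply: ge_ereal_sup => _ [n [x [x0 _ ->]]].
have -> : map_mx f x = 0 by apply/matrixP => i j; rewrite !mxE x0.
by rewrite matnorm0.
Qed.

End CbNorm.

Section CbDistortion.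
Context {R : realType}.
Implicit Types V W Z : operatorSpaceType R.

Lemma cb_distortion_ge0 V W (A : set V) (f : V -> W) :
  (0 <= cb_distortion A f)%E.
Proof.
by rewrite /cb_distortion; case: ifP => // _; rewrite mule_ge0// cbnorm_ge0.
Qed.

(** On the range of [p \o f] the inverse is [f^-1 \o q]. Bounding the cb-norms of both compositions
    and regrouping the four factors isolates the product for [p] and [q]. *)
Lemma cb_distortion_comp V W Z (p : {linear W -> Z}) (q : {linear Z -> W})
    (K : \bar R) (A : set V) (f : V -> W) :
  cancel p q -> (1 <= K)%E -> (cbnorm setT p * cbnorm setT q <= K)%E ->
  submod_closed (mem A) -> linear_on A f -> {in A &, injective f} ->
  (cb_distortion A (p \o f) <= K * cb_distortion A f)%E.
Proof.
move=> pK K1 pqK Asub flin finj.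
(* If [A] is zero, both distortions are 1 by convention and the claim is the hypothesis [1 <= K]. *)
rewrite /cb_distortion; case: ifP => _; first by rewrite mule1.
have pfinj : {in A &, injective (p \o f)}.
  by move=> x y Ax Ay /(can_inj pK); exact: finj.
have inv_pf : cbnorm ((p \o f) @` A) (inv_on A (p \o f)) =
    cbnorm ((p \o f) @` A) (inv_on A f \o q).
  apply: eq_cbnorm => _ [x Ax <-].
  by rewrite inv_onK//= pK inv_onK.
have le_pf : (cbnorm A (p \o f) <= cbnorm setT p * cbnorm A f)%E.
  apply: cbnorm_comp => //; last by move=> c x y _ _; rewrite linearP.
  by split=> [|c x y _ _]; exact: mem_set.
have le_inv : (cbnorm ((p \o f) @` A) (inv_on A f \o q) <=
    cbnorm setT q * cbnorm (f @` A) (inv_on A f))%E.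
  rewrite muleC; apply: (@le_trans _ _ (cbnorm (f @` A) (inv_on A f) *
      cbnorm ((p \o f) @` A) q)%E); last first.
    by rewrite lee_wpmul2l ?cbnorm_ge0// cbnorm_subset.
  apply: cbnorm_comp.
  - by move=> _ [x Ax <-]; exists x => //=; rewrite pK.
  - exact: submod_image.
  - exact: linear_on_inv.
rewrite inv_pf (le_trans (lee_pmul _ _ le_pf le_inv)) ?cbnorm_ge0//.
by rewrite muleACA lee_wpmul2r// mule_ge0// cbnorm_ge0.
Qed.

(** Trades the pseudo-inverse in the distortion for the linear inverse [q]. Equality fails on the
    zero space, where the product is 0 but the distortion is 1 by convention. *)
Lemma cbnorm_inv_le_distortion V W (p : {linear V -> W})
    (q : {linear W -> V}) :
  cancel p q -> cancel q p ->
  (cbnorm setT p * cbnorm setT q <= cb_distortion setT p)%E.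
Proof.
move=> pK qK; rewrite /cb_distortion; case: ifPn => [/asboolP VT|_].
  by rewrite VT cbnorm_set0 ?raddf0// mul0e.
have -> : p @` setT = setT by rewrite -subTset => y _; exists (q y).
rewrite (@eq_cbnorm _ _ _ setT q (inv_on setT p))// => y _.
by rewrite -{2}(qK y) inv_onK// => x z _ _ /(can_inj pK).
Qed.

End CbDistortion.

Theorem corollary3p4 (R : realType) (EE : operatorSpaceType R -> Prop)
    (EE_fin : forall F : operatorSpaceType R, EE F -> finite_dimensional F)
    (X : operatorSpaceType R) (X_Gurariy : Gurariy EE X)
    (Y : operatorSpaceType R) (dYX : d_cb Y X = 1%E) :
  Gurariy EE Y.
Proof.
move=> eps eps_gt0 F EEF E Esub u ulin uinj.
have [d d_gt0 d_le] : exists2 d : R, 0 < d & (1 + d) ^+ 3 <= 1 + eps.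
  (* For [0 < d <= 1], [(1 + d)^3 = 1 + 3d + 3d^2 + d^3 <= 1 + 7d], whence the 7. *)
  have d_gt0 : 0 < Num.min 1 (eps / 7) by rewrite lt_min ltr01 divr_gt0.
  have : Num.min 1 (eps / 7) <= 1 by rewrite ge_min lexx.
  have : Num.min 1 (eps / 7) <= eps / 7 by rewrite ge_min lexx orbT.
  move: (Num.min 1 (eps / 7)) d_gt0 => d d_gt0 d_le d1; exists d => //; nra.
(* The infimum 1 may not be attained, but some cb-isomorphism has distortion below [1 + d]. *)
have [_ [phi [[phi_bij _ _] ->]] phi_d] : exists2 x : \bar R,
    (exists phi : {linear Y -> X}, cb_isomorphism phi /\
      x = cb_distortion setT phi) & (x < (1 + d)%:E)%E.
  by apply: ereal_inf_lt; rewrite -/(d_cb Y X) dYX lte_fin ltrDl.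
have [psi0 phiK psiK] := phi_bij.
pose psi_lin := GRing.isLinear.Build _ _ _ _ psi0 (can2_linear phiK psiK).
pose psi : {linear X -> Y} := HB.pack psi0 psi_lin.
have K1 : (1 <= (1 + d)%:E)%E by rewrite lee_fin lerDl ltW.
have pq_d := le_trans (cbnorm_inv_le_distortion Y X phi psi phiK psiK) (ltW phi_d).
(* The bound is symmetric in [phi] and [psi], so composing with either one costs the same factor. *)
have qp_d : (cbnorm setT psi * cbnorm setT phi <= (1 + d)%:E)%E by rewrite muleC.
have phiu_lin : linear_on E (phi \o u).
  by move=> c x y Ex Ey; rewrite /= ulin// linearP.
have phiu_inj : {in E &, injective (phi \o u)}.
  by move=> x y Ex Ey /(can_inj phiK); exact: uinj.
have [v [v_inj v_ext v_dist]] :=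
  X_Gurariy d d_gt0 F EEF E Esub (phi \o u) phiu_lin phiu_inj.
exists (psi \o v); split.
- by move=> x y /(can_inj psiK)/v_inj.
- by move=> x Ex /=; rewrite v_ext//= phiK.
have ext_le : (cb_distortion setT (psi \o v) <=
    (1 + d)%:E * cb_distortion setT v)%E.
  apply: (@cb_distortion_comp _ _ _ _ psi phi) => //.
  - by split=> [|c x y _ _]; exact: mem_set.
  - by move=> c x y _ _; rewrite linearP.
  - by move=> x y _ _ /v_inj.
have phiu_le : (cb_distortion E (phi \o u) <=
    (1 + d)%:E * cb_distortion E u)%E.
  exact: (@cb_distortion_comp _ _ _ _ phi psi).
have K0 : (0 <= (1 + d)%:E)%E by exact: le_trans K1.
apply: (le_trans ext_le); apply: (le_trans (lee_wpmul2l K0 v_dist)).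
apply: (le_trans (lee_wpmul2l K0 (lee_wpmul2l K0 phiu_le))).
rewrite !muleA -!EFinM lee_wpmul2r ?cb_distortion_ge0// lee_fin.
by rewrite -expr2 -exprSr.
Qed.
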